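(* Let $A\in\mathbb{R}^{n\times m}$. As $\eta T\to\infty$, $$R^*_{cont}(\mathbf{0},T,A,-A)\ \ge\ \mathrm{Val}(A)\cdot T+\frac{1}{\eta}\left(\ln(m)-\ln\Bigl(\min_{x^*\in\mathrm{MinMaxStrats}(A)}|\mathrm{BR}(x^* )|\Bigr)\bigl(1+o_{\eta T}(1)\bigr)\right),$$ where $o_{\eta T}(1)$ denotes a term that decays to $0$ as $\eta T\to\infty$.
   Context: $\Delta(\mathcal{A})\subset\mathbb{R}^n$ and $\Delta(\mathcal{B})\subset\mathbb{R}^m$ are the probability simplices of the optimizer and the learner; $e_1,\dots,e_m$ is the standard basis of $\mathbb{R}^m$. The game is zero-sum: the optimizer's utility matrix is $A$ and the learner's is $-A$. The value of the game is $\mathrm{Val}(A)=\min_{y\in\Delta(\mathcal{B})}\max_{x\in\Delta(\mathcal{A})}x^\top Ay$. The set of the optimizer's minmax strategies is $\mathrm{MinMaxStrats}(A)=\{x\in\Delta(\mathcal{A}) : \min_{i\in[m]}x^\top Ae_i=\mathrm{Val}(A)\}$. The learner's best-response set to $x\in\Delta(\mathcal{A})$ is $\mathrm{BR}(x)=\{e_i : i\in\arg\min_{i\in[m]}x^\top Ae_i\}$. A strategy of the optimizer in the continuous-time game is a function $x:[0,T]\to\Delta(\mathcal{A})$. Against it, a learner using the Replicator Dynamics with parameter $\eta>0$ plays at time $t$ the mixed strategy $y(t)$ with $y_i(t)=\exp(-\eta\, e_i^\top A^\top\int_0^t x(s)ds)\big/\sum_{j=1}^m\exp(-\eta\, e_j^\top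 A^\top\int_0^t x(s)ds)$. $R^*_{cont}(\mathbf{0},T,A,-A)$ is the maximum over strategies $x$ of the optimizer's total reward $\int_0^T x(t)^\top A\,y(t)\,dt$ (the argument $\mathbf{0}$ means that the learner starts with zero historical rewards).
   Formalization: The factor 1+o(1) is placed inside the logarithm, ln(min|BR|·(1+o(1))); with it outside, the claim fails when min|BR|=1 (e.g. A=[0 1], where R* < ln(2)/η); for min|BR| ≥ 2 both forms are equivalent. *)

(* Defs.v *)
From HB Require Import structures.
From mathcomp Require Import all_boot all_order all_algebra.
From mathcomp Require Import all_classical all_reals all_analysis.

Set Implicit Arguments.
Unset Strict Implicit.
Unset Printing Implicit Defensive.

Import Order.TTheory GRing.Theory Num.Theory.
Import numFieldNormedType.Exports.

Local Open Scope classical_set_scope.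
Local Open Scope ring_scope.

(* Minima and maxima of real-valued functions are written [inf] and [sup].
   All the sets below to which they are applied are bounded, and nonempty when
   [0 < n] and [0 < m] (for [minmax_strats] by von Neumann's theorem), and the
   extrema are attained. *)

Definition simplex (R : realType) (n : nat) : set 'cV[R]_n :=
  [set x : 'cV[R]_n | (forall i, 0 <= x i 0) /\ \sum_i x i 0 = 1].

Definition payoff (R : realType) (n m : nat) (A : 'M[R]_(n, m))
  (x : 'cV[R]_n) (y : 'cV[R]_m) : R := (x^T *m A *m y) 0 0.

Definition basis_vec (R : realType) (m : nat) (i : 'I_m) : 'cV[R]_m :=
  delta_mx i 0.

Definition game_value (R : realType) (n m : nat) (A : 'M[R]_(n, m)) : R :=
  inf [set sup [set payoff A x y | x in @simplex R n] | y in @simplex R m].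

Definition minmax_strats (R : realType) (n m : nat) (A : 'M[R]_(n, m)) :
    set 'cV[R]_n :=
  [set x | simplex x /\
    inf (range (fun i : 'I_m => payoff A x (basis_vec R i))) = game_value A].

(* The pure best responses [e_i] of the learner, whose utility is [- A], are
   represented by their indices [i]. *)
Definition best_responses (R : realType) (n m : nat) (A : 'M[R]_(n, m))
    (x : 'cV[R]_n) : {set 'I_m} :=
  [set i | [forall j, payoff A x (basis_vec R i) <=
                      payoff A x (basis_vec R j)]]%SET.

Definition min_card_best_responses (R : realType) (n m : nat)
    (A : 'M[R]_(n, m)) : R :=
  inf [set #|best_responses A x|%:R | x in minmax_strats A].

(* Measurability is what gives a meaning to the integrals of a strategy; the
   values of [x] outside [0, T] are irrelevant. *)
Definition strategy (R : realType) (n : nat) (T : R) (x : R -> 'cV[R]_n) :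
    Prop :=
  (forall t, t \in `[0, T] -> simplex (x t)) /\
  (forall i, measurable_fun `[0, T] (fun t => x t i 0)).

Definition cumulative (R : realType) (n : nat) (x : R -> 'cV[R]_n) (t : R) :
    'cV[R]_n :=
  \col_i \int[lebesgue_measure]_(s in `[0, t]) x s i 0.

Definition replicator (R : realType) (n m : nat) (A : 'M[R]_(n, m)) (eta : R)
    (x : R -> 'cV[R]_n) (t : R) : 'cV[R]_m :=
  let w j := expR (- eta * ((basis_vec R j)^T *m A^T *m cumulative x t) 0 0) in
  \col_i (w i / \sum_j w j).

Definition total_reward (R : realType) (n m : nat) (A : 'M[R]_(n, m))
    (eta T : R) (x : R -> 'cV[R]_n) : R :=
  \int[lebesgue_measure]_(t in `[0, T]) payoff A (x t) (replicator A eta x t).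

(* The optimal reward against a learner with utility [- A] starting from zero
   historical rewards. *)
Definition optimal_reward (R : realType) (n m : nat) (A : 'M[R]_(n, m))
    (eta T : R) : R :=
  sup [set total_reward A eta T x | x in [set x | strategy T x]].

(* Main.v *)
(* The optimizer plays constantly a minmax strategy [x] with the fewest best
   responses. Writing [c_j] for the payoff of [x] against [e_j], its reward at
   time [t] is the derivative of [- ln (\sum_j exp (- eta t c_j)) / eta], so that
   its total reward is exactly [(ln m - ln (\sum_j exp (- eta T c_j))) / eta].
   Every [c_j] is at least the value [v], with equality exactly at the [k] best
   responses, hence the sum is [exp (- eta T v) (k + o(1))]. That a minmax
   strategy exists is the minimax theorem, which follows from Gordan's theorem
   of the alternative. *)
Require Import Defs.
From HB Require Import structures.
From mathcomp Require Import all_boot all_order all_algebra.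
From mathcomp Require Import all_classical all_reals all_analysis.
From mathcomp Require Import ring lra.

Set Implicit Arguments.
Unset Strict Implicit.
Unset Printing Implicit Defensive.

Import Order.TTheory GRing.Theory Num.Theory.
Import numFieldNormedType.Exports.

Local Open Scope classical_set_scope.
Local Open Scope ring_scope.

(** * Theorems of the alternative *)

(** Finitely many strict inequalities leave room for a common step [e]; [gordan] uses this to tilt a
    functional without losing its sign on the tail. *)
Lemma small_perturbation (F : realFieldType) (T : eqType) (s : seq T)
    (p q : T -> F) :
  (forall a, a \in s -> p a < 0) ->
  exists2 e, 0 < e & forall a, a \in s -> p a + e * q a < 0.
Proof.
elim: s => [|a s IH] p0; first by exists 1.
have [|e e0 He] := IH; first by move=> b bs; apply: p0; rewrite inE bs orbT.
have pa : p a < 0 by apply: p0; rewrite mem_head.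
have qa1 : 0 < `|q a| + 1 by rewrite ltr_wpDl.
(* The second bound keeps the shift at [a] below [- p a]; the [+ 1] covers [q a = 0]. The tail
   tolerates any step in between, since [p b + t * q b] is affine in [t] and negative at [0] and at
   [e]. *)
pose d := Num.min e (- p a / (2 * (`|q a| + 1))).
have d0 : 0 < d.
  by rewrite lt_min e0 divr_gt0 ?oppr_gt0 // mulr_gt0.
have dle : d * (`|q a| + 1) < - p a.
  have : d <= - p a / (2 * (`|q a| + 1)) by rewrite ge_min lexx orbT.
  rewrite ler_pdivlMr ?mulr_gt0// => H.
  have : d * (2 * (`|q a| + 1)) = d * (`|q a| + 1) *+ 2 by ring.
  move: H => /[swap] ->; lra.
exists d => // b; rewrite inE => /predU1P[->|bs].
  have := ler_norm (q a); nra.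
have de : d <= e by rewrite ge_min lexx.
have pb : p b < 0 by apply: p0; rewrite inE bs orbT.
have := He b bs; have [qb|qb] := leP 0 (q b); nra.
Qed.

Lemma dot_self_gt0 (F : realFieldType) (m : nat) (a : 'rV[F]_m) :
  a != 0 -> 0 < (a *m a^T) 0 0.
Proof.
move=> a0; rewrite mxE lt_neqAle eq_sym; apply/andP; split; last first.
  by apply: sumr_ge0 => j _; rewrite mxE -expr2 sqr_ge0.
apply: contra a0 => /eqP H.
apply/eqP/rowP => j; rewrite mxE; apply/eqP.
have /psumr_eq0P : forall j, true -> 0 <= a 0 j * a^T j 0.
  by move=> k _; rewrite mxE -expr2 sqr_ge0.
by move/(_ H j isT); rewrite mxE => /eqP; rewrite mulf_eq0 orbb.
Qed.

(* Gordan's alternative, for any convex cone [C] containing [s]. The induction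
   step projects the other vectors along the head [c] onto the hyperplane
   orthogonal to [y]. *)
Lemma gordan (F : realFieldType) (m : nat) (C : 'rV[F]_m -> Prop)
    (CD : forall a b, C a -> C b -> C (a + b))
    (CZ : forall t a, 0 < t -> C a -> C (t *: a)) (s : seq 'rV[F]_m) :
  (forall a, a \in s -> C a) ->
  C 0 \/ exists y : 'cV[F]_m, forall a, a \in s -> (a *m y) 0 0 < 0.
Proof.
have [k] := ubnP (size s); elim: k s => // k IH [|c s] /= sk Cs.
  by right; exists 0.
have Cc : C c by apply: Cs; rewrite mem_head.
have {}Cs a : a \in s -> C a by move=> as_; apply: Cs; rewrite inE as_ orbT.
have [c0|c0] := eqVneq c 0; first by left; rewrite -c0.
have [C0|[y Hy]] := IH s sk Cs; first by left.
have [cy|cy] := ltP ((c *m y) 0 0) 0.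
  by right; exists y => a; rewrite inE => /predU1P[->//|/Hy].
(* [b a] is a combination of [a] and [c] annihilated by [y]. For [a] in [s] its coefficients are
   nonnegative, because [y] is negative on [a] and not on [c], so it stays in [C]. *)
pose b a := (c *m y) 0 0 *: a + (- (a *m y) 0 0) *: c.
have Cb a : a \in map b s -> C a.
  move=> /mapP[{}a as_ ->]; rewrite /b.
  have Cac : C (- (a *m y) 0 0 *: c) by apply: CZ => //; rewrite oppr_gt0 Hy.
  move: cy; rewrite le_eqVlt => /predU1P[<-|cy]; first by rewrite scale0r add0r.
  by apply: CD => //; apply: CZ => //; exact: Cs.
have [|C0|[z Hz]] := IH (map b s) _ Cb; [by rewrite size_map|by left|].
(* Pairing [a] with [w] amounts to pairing [b a] with [z], so [w] is negative on [s] and vanishes on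
   [c]. A small tilt along [- c^T] makes it negative on [c] too. *)
pose w := (c *m y) 0 0 *: z - (c *m z) 0 0 *: y.
have Hw a : (a *m w) 0 0 = (b a *m z) 0 0.
  rewrite /w /b mulmxDr mulmxN mulmxDl -!scalemxAr -!scalemxAl.
  move: (a *m z) (c *m z) (a *m y) (c *m y) => az cz ay cy'.
  by rewrite !mxE; ring.
have [a as_|e e0 He] := @small_perturbation F _ s (fun a => (a *m w) 0 0)
  (fun a => (a *m - c^T) 0 0).
  by rewrite Hw; apply: Hz; exact: map_f.
right; exists (w + e *: - c^T) => a.
have -> : (a *m (w + e *: - c^T)) 0 0 = (a *m w) 0 0 + e * (a *m - c^T) 0 0.
  by rewrite mulmxDr -scalemxAr mxE [X in _ + X]mxE.
rewrite inE => /predU1P[->|]; last exact: He.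
have -> : (c *m w) 0 0 = 0.
  by rewrite Hw /b scaleNr subrr mul0mx mxE.
by rewrite add0r mulmxN mxE mulrN oppr_lt0 mulr_gt0 // dot_self_gt0.
Qed.

(** Gordan's alternative for the cone of vectors [x^T *m B - z] with [x], [z] nonnegative and not
    both zero. If it contains 0, then [x^T *m B = z] is nonnegative; in the other case the
    functional is negative on the rows of [B] and on the negated basis vectors, which makes [y]
    positive. *)
Lemma ville (F : realFieldType) (n m : nat) (B : 'M[F]_(n, m)) :
  (exists x : 'cV[F]_n, [/\ forall i, 0 <= x i 0, 0 < \sum_i x i 0 &
     forall j, 0 <= (x^T *m B) 0 j]) \/
  (exists y : 'cV[F]_m, (forall j, 0 < y j 0) /\
     forall i, (B *m y) i 0 < 0).
Proof.
pose C (c : 'rV[F]_m) := exists (x : 'cV[F]_n) (z : 'rV[F]_m),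
  [/\ forall i, 0 <= x i 0, forall j, 0 <= z 0 j,
      0 < \sum_i x i 0 + \sum_j z 0 j & c = x^T *m B - z].
pose s := [seq row i B | i <- enum 'I_n] ++
          [seq - delta_mx 0 j : 'rV[F]_m | j <- enum 'I_m].
have [a b [x [z [x0 z0 xz ->]]] [x' [z' [x0' z0' xz' ->]]]|
  t a t0 [x [z [x0 z0 xz ->]]]|a|[x [z [x0 z0 xz E]]]|[y Hy]] :=
  @gordan F m C _ _ s.
- exists (x + x'), (z + z'); split=> [i|j||].
  + by rewrite mxE addr_ge0.
  + by rewrite mxE addr_ge0.
  + under eq_bigr do rewrite mxE; under [X in _ + X]eq_bigr do rewrite mxE.
    by rewrite !big_split /= addrACA addr_gt0.
  + by rewrite linearD /= mulmxDl opprD addrACA.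
- exists (t *: x), (t *: z); split=> [i|j||].
  + by rewrite mxE mulr_ge0 // ltW.
  + by rewrite mxE mulr_ge0 // ltW.
  + under eq_bigr do rewrite mxE; under [X in _ + X]eq_bigr do rewrite mxE.
    by rewrite -!mulr_sumr -mulrDr mulr_gt0.
  + by rewrite linearZ /= -scalemxAl scalerBr.
- rewrite mem_cat => /orP[] /mapP[i _ ->].
  + exists (delta_mx i 0), 0; split=> [k|j||].
    * by rewrite mxE ler0n.
    * by rewrite mxE.
    * rewrite (bigD1 i) //= mxE !eqxx [X in _ + X]big1 => [|k _]; last by rewrite mxE.
      by rewrite addr0 ltr_wpDr // sumr_ge0 // => k _; rewrite mxE ler0n.
    * by rewrite trmx_delta -rowE subr0.
  + exists 0, (delta_mx 0 i); split=> [k|j||].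
    * by rewrite mxE.
    * by rewrite mxE ler0n.
    * rewrite [X in X + _]big1 => [|k _]; last by rewrite mxE.
      rewrite add0r (bigD1 i) //= mxE !eqxx.
      by rewrite ltr_wpDr // sumr_ge0 // => k _; rewrite mxE ler0n.
    * by rewrite trmx0 mul0mx sub0r.
- left; exists x.
  have xB : x^T *m B = z by apply/eqP; rewrite -subr_eq0 -E.
  split=> // [|j]; last by rewrite xB.
  rewrite lt_neqAle sumr_ge0 ?andbT //.
  (* Were the mass of [x] zero, [x] and hence [z = x^T *m B] would vanish, against [xz]. *)
  apply/negP => /eqP Hx.
  have xi0 i : x i 0 = 0.
    by have /psumr_eq0P H : forall i, true -> 0 <= x i 0 by []; rewrite H.
  have x_0 : x = 0 by apply/colP => i; rewrite xi0 mxE.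
  move: xz; rewrite -Hx add0r -xB x_0 trmx0 mul0mx big1 ?ltxx // => j _.
  by rewrite mxE.
- right; exists y; split=> [j|i].
  + have : - delta_mx 0 j \in s.
      by rewrite mem_cat; apply/orP; right; apply: map_f; rewrite mem_enum.
    by move/Hy; rewrite mulNmx mxE -rowE mxE oppr_lt0.
  + have : row i B \in s.
      by rewrite mem_cat; apply/orP; left; apply: map_f; rewrite mem_enum.
    by move/Hy; rewrite -row_mul mxE.
Qed.

(** * Zero-sum games and the minimax theorem *)

Section zero_sum.
Context (R : realType) (n m : nat).
Implicit Types (A : 'M[R]_(n, m)) (x : 'cV[R]_n) (y : 'cV[R]_m).

Lemma payoffEr A x y :
  payoff A x y = \sum_j payoff A x (basis_vec R j) * y j 0.
Proof.
rewrite /payoff mxE; apply: eq_bigr => j _.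
by rewrite /basis_vec -colE [X in _ = X * _]mxE.
Qed.

Lemma payoffEl A x y : payoff A x y = \sum_i x i 0 * (A *m y) i 0.
Proof. by rewrite /payoff -mulmxA mxE; apply: eq_bigr => i _; rewrite mxE. Qed.

Lemma simplex_le1 k (x : 'cV[R]_k) i : simplex x -> x i 0 <= 1.
Proof.
move=> [x0 <-]; rewrite (bigD1 i) //= lerDl; exact: sumr_ge0.
Qed.

Lemma simplex_basis k (i : 'I_k) : simplex (basis_vec R i).
Proof.
split=> [j|]; first by rewrite mxE ler0n.
rewrite (bigD1 i) //= mxE !eqxx big1 ?addr0 // => j /negPf ji.
by rewrite mxE ji.
Qed.

Lemma normr_payoff_le A x y : simplex x -> simplex y ->
  `|payoff A x y| <= \sum_i \sum_j `|A i j|.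
Proof.
move=> sx sy; rewrite payoffEl (le_trans (ler_norm_sum _ _ _)) //.
apply: ler_sum => i _; rewrite normrM ger0_norm; last by case: sx.
apply: (@le_trans _ _ `|(A *m y) i 0|); first by rewrite ler_piMl ?simplex_le1.
rewrite mxE.
rewrite (le_trans (ler_norm_sum _ _ _)) //; apply: ler_sum => j _.
rewrite normrM [X in _ * X]ger0_norm; last by case: sy.
by rewrite ler_piMr // simplex_le1.
Qed.

Lemma has_sup_payoff A y : (0 < n)%N -> simplex y ->
  has_sup [set payoff A x y | x in @simplex R n].
Proof.
move=> hn sy; split.
  exists (payoff A (basis_vec R (Ordinal hn)) y).
  by exists (basis_vec R (Ordinal hn)) => //; exact: simplex_basis.
exists (\sum_i \sum_j `|A i j|) => _ [x sx <-].
by rewrite (le_trans (ler_norm _)) // normr_payoff_le.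
Qed.

Lemma le_game_value A v : (0 < m)%N ->
  (forall y, simplex y -> v <= sup [set payoff A x y | x in @simplex R n]) ->
  v <= game_value A.
Proof.
move=> hm H; apply: lb_le_inf; last by move=> _ [y sy <-]; exact: H.
by eexists; exists (basis_vec R (Ordinal hm)); [exact: simplex_basis|].
Qed.

Lemma game_value_le A y : (0 < n)%N -> simplex y ->
  game_value A <= sup [set payoff A x y | x in @simplex R n].
Proof.
move=> hn sy; apply: ge_inf; last by exists y.
pose x := basis_vec R (Ordinal hn).
have sx : simplex x by exact: simplex_basis.
(* The inner suprema are bounded below uniformly: each is at least the payoff of one fixed pure
   strategy. *)
exists (- \sum_i \sum_j `|A i j|) => _ [z sz <-].
apply: (@le_trans _ _ (payoff A x z)); last first.
  by apply: ub_le_sup; [case: (has_sup_payoff A hn sz)|exists x].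
by rewrite lerNl (le_trans _ (normr_payoff_le A sx sz)) // -normrN ler_norm.
Qed.

(** The easy half of the minimax theorem: the payoff against a mixed reply averages those against
    pure ones, so [x] secures [v] against every [y]. *)
Lemma guarantee_le_game_value A x v : (0 < n)%N -> (0 < m)%N -> simplex x ->
  (forall j, v <= payoff A x (basis_vec R j)) -> v <= game_value A.
Proof.
move=> hn hm sx vx; apply: le_game_value => // y sy.
apply: (@le_trans _ _ (payoff A x y)); last first.
  by apply: ub_le_sup; [case: (has_sup_payoff A hn sy)|exists x].
case: (sy) => y0 y1; rewrite payoffEr -[v]mulr1 -y1 mulr_sumr.
by apply: ler_sum => j _; rewrite ler_wpM2r.
Qed.

(* The nontrivial half of von Neumann's theorem. *)
Lemma exists_guarantee A : (0 < n)%N -> (0 < m)%N ->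
  exists2 x, simplex x &
    forall j, game_value A <= payoff A x (basis_vec R j).
Proof.
move=> hn hm; set v := game_value A.
(* After shifting by [v], the vector [x] normalises to a strategy guaranteeing [v], while [y] would
   normalise to a mixed reply [z] holding every row strictly below [v]. *)
have [[x [x0 xs Hx]]|[y [y0 Hy]]] := ville (A - const_mx v).
  pose S := \sum_i x i 0.
  exists (S^-1 *: x).
    split=> [i|]; first by rewrite mxE mulr_ge0 // invr_ge0 ltW.
    by under eq_bigr do rewrite mxE; rewrite -mulr_sumr mulVf // gt_eqF.
  move=> j; have := Hx j; rewrite mulmxBr mxE [X in _ + X]mxE.
  have -> : (x^T *m (const_mx v : 'M[R]_(n, m))) 0 j = S * v.
    by rewrite mxE mulr_suml; apply: eq_bigr => i _; rewrite !mxE.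
  rewrite subr_ge0 => H.
  rewrite /payoff linearZ /= -!scalemxAl mxE mulrC ler_pdivlMr //.
  by rewrite mulrC (le_trans H) // /basis_vec -colE [leRHS]mxE.
pose S := \sum_j y j 0.
have S0 : 0 < S.
  rewrite /S (bigD1 (Ordinal hm)) //= ltr_wpDr // sumr_ge0 // => j _.
  exact: ltW.
pose z := S^-1 *: y.
have sz : simplex z.
  split=> [i|]; first by rewrite mxE mulr_ge0 ?invr_ge0 ?ltW.
  by under eq_bigr do rewrite mxE; rewrite -mulr_sumr mulVf // gt_eqF.
have Az i : (A *m z) i 0 < v.
  have := Hy i; rewrite mulmxBl mxE [X in _ + X]mxE.
  have -> : ((const_mx v : 'M[R]_(n, m)) *m y) i 0 = v * S.
    by rewrite mxE mulr_sumr; apply: eq_bigr => j _; rewrite !mxE.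
  rewrite subr_lt0 => H.
  by rewrite /z -scalemxAr mxE mulrC ltr_pdivrMr.
(* Strictness survives the supremum over [x], which is at most the maximum over the finitely many
   rows; this contradicts [game_value_le]. *)
pose i0 := [arg max_(i > Ordinal hn) (A *m z) i 0]%O.
have Hi0 i : (A *m z) i 0 <= (A *m z) i0 0.
  by rewrite /i0; case: arg_maxP => //= k _ H; exact: H.
have := game_value_le A hn sz; rewrite leNgt => /negP[].
apply: le_lt_trans (Az i0); apply: ge_sup.
  by case: (has_sup_payoff A hn sz).
move=> _ [x [x0 xs] <-]; rewrite payoffEl -[leRHS]mul1r -xs mulr_suml.
by apply: ler_sum => i _; rewrite ler_wpM2l.
Qed.

Lemma inf_range_ord (f : 'I_m -> R) (i0 : 'I_m) :
  (forall i, f i0 <= f i) -> inf (range f) = f i0.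
Proof.
move=> H; apply/eqP; rewrite eq_le; apply/andP; split.
  by apply: ge_inf; [exists (f i0) => _ [i _ <-]|exists i0].
by apply: lb_le_inf; [exists (f i0), i0|move=> _ [i _ <-]].
Qed.

Lemma exists_argmin (f : 'I_m -> R) : (0 < m)%N ->
  exists i0, forall i, f i0 <= f i.
Proof.
move=> hm; exists [arg min_(i < Ordinal hm) f i]%O.
by case: arg_minP => //= k _ H i; exact: H.
Qed.

Lemma minmax_strats_nonempty A : (0 < n)%N -> (0 < m)%N ->
  minmax_strats A !=set0.
Proof.
move=> hn hm; have [x sx Hx] := exists_guarantee A hn hm.
exists x; split=> //.
have [i0 Hi0] := exists_argmin (fun i => payoff A x (basis_vec R i)) hm.
rewrite (inf_range_ord Hi0); apply/eqP; rewrite eq_le Hx andbT.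
exact: guarantee_le_game_value sx Hi0.
Qed.

(** The smallest pure payoff is the value, so the best responses are the columns paying exactly it.
    This splits the final sum into leading and decaying exponentials. *)
Lemma minmax_strats_best_responses A x : (0 < m)%N -> minmax_strats A x ->
  [/\ simplex x,
      forall j, game_value A <= payoff A x (basis_vec R j),
      forall j, (j \in best_responses A x) =
                (payoff A x (basis_vec R j) == game_value A) &
      (0 < #|best_responses A x|)%N].
Proof.
move=> hm [sx].
have [i0 Hi0] := exists_argmin (fun i => payoff A x (basis_vec R i)) hm.
rewrite (inf_range_ord Hi0) => vE.
have BE j : (j \in best_responses A x) =
            (payoff A x (basis_vec R j) == game_value A).
  rewrite inE -vE eq_le Hi0 andbT.
  by apply/forallP/idP => [->//|H k]; exact: le_trans H (Hi0 k).
split=> // [j|]; first by rewrite -vE Hi0.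
by apply/card_gt0P; exists i0; rewrite BE vE.
Qed.

(** Cardinalities are natural numbers, so a least one exists and the real [inf] equals it. *)
Lemma min_card_best_responses_attained A : (0 < n)%N -> (0 < m)%N ->
  exists2 x, minmax_strats A x &
    min_card_best_responses A = #|best_responses A x|%:R.
Proof.
move=> hn hm; have [x0 Mx0] := minmax_strats_nonempty A hn hm.
pose P k := `[< exists2 x, minmax_strats A x & #|best_responses A x| = k >].
have exP : exists k, P k by exists #|best_responses A x0|; apply/asboolP; exists x0.
case: (ex_minnP exP) => k /asboolP[x Mx <-] Hk.
exists x => //; apply/eqP; rewrite eq_le; apply/andP; split.
  apply: ge_inf; last by exists x.
  by exists 0 => _ [z _ <-]; rewrite ler0n.
apply: lb_le_inf; first by eexists; exists x.
by move=> _ [z Mz <-]; rewrite ler_nat; apply: Hk; apply/asboolP; exists z.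
Qed.

End zero_sum.

(** * Integral bounds and the integral of a softmax average *)

(* [f] is not assumed to be measurable: the integral of a nonnegative function
   is a supremum over the simple functions below it, hence monotone. *)
Lemma Rintegral_le_cst (d : measure_display) (T : measurableType d)
    (R : realType) (mu : {measure set T -> \bar R}) (D : set T) (f : T -> R)
    (M : R) :
  measurable D -> (mu D < +oo)%E -> 0 <= M -> (forall x, D x -> f x <= M) ->
  Rintegral mu D f <= M * fine (mu D).
Proof.
move=> mD muD M0 fM; rewrite /Rintegral.
have H : (\int[mu]_(x in D) (EFin \o f)^\+ x <= M%:E * mu D)%E.
  rewrite -integral_cst // !(integral_mkcond D).
  rewrite ge0_integralTE; last by move=> x; apply: erestrict_ge0.
  rewrite ge0_integralTE; last first.
    by move=> x; apply: erestrict_ge0 => y _; rewrite lee_fin.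
  apply: ereal_sup_le => _ [h Hh <-]; exists h => // x.
  apply: (le_trans (Hh x)); apply: lee_restrict => y Dy /=.
  by rewrite funeposE ge_max /= !lee_fin fM // M0.
rewrite -[X in M * X]/(fine (mu D)) -[M]/(fine M%:E) -fineM //; last first.
  by rewrite ge0_fin_numE.
rewrite integralE.
have ip : (0 <= \int[mu]_(x in D) (EFin \o f)^\+ x)%E by exact: integral_ge0.
have im : (0 <= \int[mu]_(x in D) (EFin \o f)^\- x)%E by exact: integral_ge0.
have Mfin : (M%:E * mu D)%E \is a fin_num by rewrite fin_numM // ge0_fin_numE.
have ipfin : (\int[mu]_(x in D) (EFin \o f)^\+ x)%E \is a fin_num.
  by rewrite ge0_fin_numE // (le_lt_trans H) // ltey_eq Mfin.
move: ipfin H ip im Mfin.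
(* If the negative part has infinite integral, [fine] sends the total [-oo] to 0, which is still at
   most [q] because [0 <= p <= q]. *)
case: (\int[mu]_(x in D) (EFin \o f)^\+ x)%E => // p _.
case: (M%:E * mu D)%E => // q.
case: (\int[mu]_(x in D) (EFin \o f)^\- x)%E => [r| |] //=; rewrite !lee_fin => *;
  lra.
Qed.

Section log_sum_exp.
Context (R : realType) (m : nat) (c : 'I_m -> R) (eta : R).

Let S (t : R) : R := \sum_j expR (- (eta * (t * c j))).

Lemma sum_expR_gt0 (f : 'I_m -> R) : (0 < m)%N -> 0 < \sum_j expR (f j).
Proof.
move=> hm; rewrite (bigD1 (Ordinal hm)) //= ltr_wpDr ?expR_gt0 //.
by apply: sumr_ge0 => j _; exact: expR_ge0.
Qed.

Lemma is_derive_sum_expR (t : R) :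
  is_derive t 1 S (\sum_j - (eta * c j) * expR (- (eta * (t * c j)))).
Proof.
have -> : S = \sum_j (fun t => expR (- (eta * (t * c j)))).
  by apply/funext => s; rewrite fct_sumE.
apply: is_derive_sum => j.
have D : is_derive t 1 (fun t => - (eta * (t * c j))) (- (eta * c j)).
  have -> : (fun t => - (eta * (t * c j))) = (- (eta * c j)) \*: (id : R -> R).
    by apply/funext => s /=; rewrite /GRing.scale /=; ring.
  by apply: is_derive_eq; rewrite /GRing.scale /= mulr1.
rewrite mulrC; exact: (is_derive1_comp (is_derive_expR _) D).
Qed.

Lemma is_derive_ln_sum_expR (t : R) : (0 < m)%N -> eta != 0 ->
  is_derive t 1 (fun t => - eta^-1 * ln (S t))
    (\sum_j c j * (expR (- (eta * (t * c j))) / S t)).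
Proof.
move=> hm eta0.
have S0 : 0 < S t by exact: sum_expR_gt0.
have D := is_derive1_comp (is_derive1_ln S0) (is_derive_sum_expR t).
have -> : (fun t => - eta^-1 * ln (S t)) = - eta^-1 \*: (@ln R \o S) by [].
apply: is_derive_eq; rewrite /GRing.scale /= mulrA mulr_sumr.
apply: eq_bigr => j _; field.
by rewrite eta0 gt_eqF.
Qed.

(** The fundamental theorem of calculus with log-sum-exp as antiderivative; [ln m] comes from
    [S 0 = m]. *)
Lemma Rintegral_softmax (T : R) : (0 < m)%N -> 0 < eta -> 0 < T ->
  \int[lebesgue_measure]_(t in `[0, T])
    (\sum_j c j * (expR (- (eta * (t * c j))) / S t)) =
  eta^-1 * (ln m%:R - ln (S T)).
Proof.
move=> hm e0 T0.
have eN : eta != 0 by rewrite gt_eqF.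
have dF t := is_derive_ln_sum_expR t hm eN.
have cF : continuous (fun t => - eta^-1 * ln (S t)).
  move=> t; apply/differentiable_continuous/derivable1_diffP.
  by case: (dF t).
have cS : continuous S.
  move=> t; apply/differentiable_continuous/derivable1_diffP.
  by case: (is_derive_sum_expR t).
rewrite /Rintegral (continuous_FTC2 (F := fun t => - eta^-1 * ln (S t))) //.
- rewrite -EFinB /= [S 0](_ : _ = m%:R); first by ring.
  rewrite /S; under eq_bigr do rewrite mul0r mulr0 oppr0 expR0.
  by rewrite sumr_const card_ord.
- apply: continuous_subspaceT => t.
  apply: cvg_big => [|j _]; first exact: add_continuous.
  apply: cvgM; first exact: cvg_cst.
  apply: cvgM; last first.
    by apply: cvgV; [rewrite gt_eqF // sum_expR_gt0|exact: cS].
  apply: (@cvg_comp _ _ _ (fun t => - (eta * (t * c j))) expR); last first.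
    exact: continuous_expR.
  by apply: cvgN; apply: cvgM; [exact: cvg_cst|apply: cvgM; [|exact: cvg_cst]].
- split=> [t _||].
  + by case: (dF t).
  + exact/cvg_at_right_filter/cF.
  + exact/cvg_at_left_filter/cF.
- by move=> t _; rewrite derive1E (derive_val (is_derive := dF t)).
Qed.

End log_sum_exp.

(** * Rewards of the optimizer *)

Section reward.
Context (R : realType) (n m : nat).
Implicit Types (A : 'M[R]_(n, m)) (x : R -> 'cV[R]_n).

Lemma replicator_simplex A eta x t : (0 < m)%N ->
  simplex (replicator A eta x t).
Proof.
move=> hm; split=> [j|]; rewrite ?mxE.
  by rewrite divr_ge0 ?expR_ge0 // ltW // sum_expR_gt0.
under eq_bigr do rewrite mxE.
by rewrite -mulr_suml divff // gt_eqF // sum_expR_gt0.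
Qed.

Lemma lebesgue_measure_itv0 (t : R) : 0 <= t ->
  lebesgue_measure (`[0, t] : set R) = t%:E.
Proof.
rewrite lebesgue_measure_itv /= lte_fin le_eqVlt => /predU1P[<-|t0].
  by rewrite ltxx.
by rewrite t0 -EFinB subr0.
Qed.

Lemma strategy_cst (T : R) (z : 'cV[R]_n) : simplex z -> strategy T (fun=> z).
Proof. by move=> sz; split=> // i; exact: measurable_cst. Qed.

Lemma cumulative_cst (z : 'cV[R]_n) (t : R) : 0 <= t ->
  Defs.cumulative (fun=> z) t = t *: z.
Proof.
move=> t0; apply/colP => i; rewrite !mxE Rintegral_cst //.
by rewrite [RHS]mulrC; congr (_ * _); exact: (congr1 fine (lebesgue_measure_itv0 t0)).
Qed.

(** Under constant play the cumulative strategy is [t *: z], so the replicator is the softmax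
    integrated in [Rintegral_softmax]. *)
Lemma total_reward_cst A (eta T : R) (z : 'cV[R]_n) : (0 < m)%N -> 0 < eta -> 0 < T ->
  total_reward A eta T (fun=> z) =
  eta^-1 * (ln m%:R -
    ln (\sum_j expR (- (eta * (T * payoff A z (basis_vec R j)))))).
Proof.
move=> hm e0 T0.
rewrite -(Rintegral_softmax (fun j => payoff A z (basis_vec R j))) //.
apply: eq_Rintegral => t; rewrite inE /= in_itv /= => /andP[t0 _].
rewrite payoffEr; apply: eq_bigr => j _; congr (_ * _); rewrite mxE.
have E k : - eta * ((basis_vec R k)^T *m A^T *m Defs.cumulative (fun=> z) t) 0 0 =
    - (eta * (t * payoff A z (basis_vec R k))).
  rewrite cumulative_cst // -scalemxAr mxE mulNr; congr (- (_ * (_ * _))).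
  transitivity ((z^T *m A *m basis_vec R k)^T 0 0); last by rewrite mxE.
  by rewrite !trmx_mul trmxK mulmxA.
by congr (_ / _); [rewrite E|apply: eq_bigr => k _; rewrite E].
Qed.

(** Every reward is at most [T] times the sum of the absolute entries of [A], so the [sup] is taken
    over a bounded set. *)
Lemma total_reward_le_optimal A eta T x : (0 < m)%N -> 0 <= T ->
  strategy T x -> total_reward A eta T x <= optimal_reward A eta T.
Proof.
move=> hm T0 sx; apply: ub_le_sup; last by exists x.
pose M := \sum_i \sum_j `|A i j|.
exists (M * fine (lebesgue_measure (`[0, T] : set R))) => _ [z [sz _] <-].
apply: Rintegral_le_cst => //.
- suff : (lebesgue_measure (`[0%R, T] : set R) < +oo)%E by [].
  by rewrite lebesgue_measure_itv0 // ltry.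
- by apply: sumr_ge0 => i _; apply: sumr_ge0.
- move=> t tT; rewrite (le_trans (ler_norm _)) // normr_payoff_le //.
    exact: sz.
  exact: replicator_simplex.
Qed.

End reward.

(** One [eps], depending on [A] alone, serves all pairs [eta], [T] through their product. It stands
    inside the logarithm, so the error term remains when there is a single best response and its
    logarithm is 0. *)
Theorem proposition7 (R : realType) (n m : nat) (hn : (0 < n)%N)
    (hm : (0 < m)%N) (A : 'M[R]_(n, m)) :
  exists eps : R -> R,
    (eps s @[s --> +oo] --> (0 : R)) /\
    (forall eta T : R, 0 < eta -> 0 < T ->
       game_value A * T +
         eta^-1 * (ln m%:R -
           ln (min_card_best_responses A * (1 + eps (eta * T))))
       <= optimal_reward A eta T).
Proof.
have [x Mx ->] := min_card_best_responses_attained A hn hm.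
have [sx vx BE k0] := minmax_strats_best_responses hm Mx.
set v := game_value A in vx BE *; set B := best_responses A x in BE k0 *.
pose c j := payoff A x (basis_vec R j).
(* The total weight of the suboptimal columns relative to that of the best responses; every gap
   [c j - v] off [B] is positive, so it decays. *)
pose eps (s : R) := #|B|%:R^-1 * \sum_(j | j \notin B) expR (- ((c j - v) * s)).
exists eps; split.
  suff : eps s @[s --> +oo] --> #|B|%:R^-1 * \sum_(j | j \notin B) (0 : R).
    by rewrite big1_eq mulr0.
  apply: cvgM; first exact: cvg_cst.
  apply: cvg_big => [|j jB]; first exact: add_continuous.
  apply: (@cvg_comp _ _ _ (fun s => (c j - v) * s) (fun s => expR (- s))).
    apply: gt0_cvgMry; last exact: cvg_id.
    by rewrite subr_gt0 lt_neqAle vx eq_sym -BE jB.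
  exact: cvgr_expR.
move=> eta T e0 T0.
apply: le_trans (total_reward_le_optimal A eta hm (ltW T0) (strategy_cst T sx)).
rewrite total_reward_cst // le_eqVlt; apply/orP; left; apply/eqP.
have kR : (#|B|%:R : R) != 0 by rewrite pnatr_eq0 -lt0n.
(* Factoring out the weight at payoff [v], each best response contributes 1 and the other columns
   together [#|B| * eps]. *)
have -> : \sum_j expR (- (eta * (T * payoff A x (basis_vec R j)))) =
    expR (- (eta * T * v)) * (#|B|%:R * (1 + eps (eta * T))).
  rewrite /eps mulrDr mulr1 mulVKf // mulrDr (bigID (fun j => j \in B)) /=.
  congr (_ + _).
    rewrite mulr_natr -sumr_const; apply: eq_bigr => j.
    by rewrite BE => /eqP ->; rewrite mulrA.
  rewrite mulr_sumr; apply: eq_bigr => j _; rewrite -expRD; congr expR.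
  by rewrite /c; ring.
have P : 0 < #|B|%:R * (1 + eps (eta * T)).
  rewrite mulr_gt0 ?ltr0n // ltr_wpDr // mulr_ge0 ?invr_ge0 //.
  by apply: sumr_ge0 => j _; exact: expR_ge0.
rewrite [ln (expR _ * _)]lnM ?posrE ?expR_gt0 //.
by rewrite expRK; field; rewrite gt_eqF.
Qed.
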